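(* Let $n\ge1$, let $\Lambda_1=(r_0,r_1,\dots,r_n)$ with $0=r_0<r_1<\cdots<r_n$ be real numbers, let $\rho>0$ be a real number with $\rho\ne r_i$ for all $i$, and let $\Lambda_2$ be the sequence obtained by arranging $r_0,r_1,\dots,r_n,\rho$ in strictly increasing order. Let $P_0,\dots,P_n$ and $\tilde P_0,\dots,\tilde P_{n+1}$ be the coefficients of the same element $P$ in $$P(t)=\sum_{k=0}^{n}H^{n}_{k,\Lambda_1}(t)P_k=\sum_{k=0}^{n+1}H^{n+1}_{k,\Lambda_2}(t)\tilde P_k .$$ Then $\tilde P_0=P_0$ and $\tilde P_{n+1}=P_n$, and moreover: (i) if $\rho>r_n$, then $\tilde P_k=\frac{r_k}{\rho}P_{k-1}+\frac{\rho-r_k}{\rho}P_k$ for $k=1,\dots,n$; (ii) if $\rho<r_1$, then $\tilde P_{k+1}=P_k$ for $k=0,\dots,n-1$; (iii) if $r_{s-1}<\rho<r_{s}$ for some $s\in\{2,\dots,n\}$, then $\tilde P_k=\frac{r_k}{\rho}P_{k-1}+\frac{\rho-r_k}{\rho}P_k$ for $k=1,\dots,s-1$, and $\tilde P_k=P_{k-1}$ for $k=s,\dots,n+1$.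
   Context: For pairwise distinct reals $x_0,\dots,x_m$, $[x_0,\dots,x_m]f=\sum_{i=0}^m \frac{f(x_i)}{\prod_{j\ne i}(x_i-x_j)}$. Put $f_t(x)=t^x$ (with $0^0=1$). For a sequence $\Lambda=(0=r_0<r_1<\cdots<r_n)$, the Gelfond-Bernstein basis of $\mathrm{span}(1,t^{r_1},\dots,t^{r_n})$ with respect to $[0,1]$ is $H^n_{k,\Lambda}(t)=(-1)^{n-k}r_{k+1}\cdots r_n[r_k,\dots,r_n]f_t$ for $0\le k\le n-1$ and $H^n_{n,\Lambda}(t)=t^{r_n}$. The coefficients $P_k$, $\tilde P_k$ are real numbers, or points of $\mathbb{R}^d$, $d\ge1$. *)

(* Defs.v *)
From mathcomp Require Import all_boot all_order all_algebra.
From mathcomp Require Import all_classical all_reals all_analysis.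

Set Implicit Arguments.
Unset Strict Implicit.
Unset Printing Implicit Defensive.

Import Order.TTheory GRing.Theory Num.Theory.
Local Open Scope ring_scope.

Definition divided_difference (R : fieldType) (x : seq R) (f : R -> R) : R :=
  \sum_(i < size x) f x`_i / \prod_(j < size x | j != i) (x`_i - x`_j).

(* H^n_{k,L}(t) for L = (r_0, ..., r_n), meaningful for k <= n and t in [0, 1].
   powR satisfies 0 `^ 0 = 1 and 0 `^ x = 0 for x != 0, as required at t = 0. *)
Definition gelfond_bernstein (R : realType) (n : nat) (L : n.+1.-tuple R)
    (k : nat) (t : R) : R :=
  if k == n then t `^ L`_n
  else (-1) ^+ (n - k) * (\prod_(k.+1 <= i < n.+1) L`_i)
       * divided_difference (drop k L) (fun x => t `^ x).

(* Main.v *)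
(** The basis functions are values of linear functionals:
    [H^n_(k, L)(t)] is [gb_functional (drop k L)] at [x |-> t `^ x].  The
    two-point recurrence of divided differences, applied to the nodes [r_k] and
    [rho], gives
      [H^n_(k, L1) = (rho - r_k) / rho * H^(n+1)_(k, L2)
                     + L2`_k.+1 / rho * H^(n+1)_(k+1, L2)]
    when [r_k < rho], and [H^n_(k, L1) = H^(n+1)_(k+1, L2)] otherwise.  The
    formulas for the coefficients then follow from the linear independence of
    the [H^(n+1)_(k, L2)] on [[0, 1]].  At [t = e^-m] one has
    [t `^ x = y ^+ m] with [y = e^-x], so a linear relation between the
    [H^(n+1)_(k, L2)(t)] extends to the functionals evaluated at all functions
    [x |-> p.[e^-x]] with [p] a polynomial; taking for [p] the monic polynomial
    with roots [e^-(L2`_i)], [i > k], isolates the [k]-th coefficient once the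
    previous ones are known to vanish. *)
Require Import Defs.
From mathcomp Require Import all_boot all_order all_algebra.
From mathcomp Require Import all_classical all_reals all_analysis.
From mathcomp Require Import ring.

Set Implicit Arguments.
Unset Strict Implicit.
Unset Printing Implicit Defensive.

Import Order.TTheory GRing.Theory Num.Theory.
Local Open Scope ring_scope.

(** * Divided differences at distinct nodes *)

(** Summing over nodes instead of positions turns symmetry in the nodes into a reordering of big
    operators. *)
Lemma divided_differenceE (R : fieldType) (s : seq R) (f : R -> R) : uniq s ->
  divided_difference s f =
  \sum_(x <- s) f x / \prod_(y <- s | y != x) (x - y).
Proof.
move=> us; rewrite /divided_difference (big_nth 0) big_mkord.
apply: eq_bigr => i _; congr (_ / _); rewrite (big_nth 0) big_mkord.
by apply: eq_bigl => j; rewrite nth_uniq.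
Qed.

Lemma perm_divided_difference (R : fieldType) (s s' : seq R) (f : R -> R) :
  uniq s -> perm_eq s s' -> divided_difference s f = divided_difference s' f.
Proof.
move=> us ss'; rewrite !divided_differenceE -?(perm_uniq ss') //.
rewrite (perm_big _ ss'); apply: eq_bigr => x _.
by congr (_ / _); apply: perm_big.
Qed.

Lemma divided_difference1 (R : fieldType) (x : R) (f : R -> R) :
  divided_difference [:: x] f = f x.
Proof.
by rewrite divided_differenceE// big_seq1 big_cons eqxx big_nil divr1.
Qed.

Lemma divided_difference_rec (R : fieldType) (a b : R) (s : seq R)
    (f : R -> R) : uniq [:: a, b & s] ->
  (b - a) * divided_difference [:: a, b & s] f =
  divided_difference (b :: s) f - divided_difference (a :: s) f.
Proof.
move=> /[dup] uabs; rewrite /= inE negb_or => /andP[/andP[ab as_] /andP[bs us]].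
rewrite !divided_differenceE//=; do ?by apply/andP.
have prodN z : z \notin s ->
    \prod_(y <- s | y != z) (z - y) = \prod_(y <- s) (z - y).
  move=> zs; rewrite [LHS]big_seq_cond [RHS]big_seq; apply: eq_bigl => y.
  by apply: andb_idr; apply: contraTneq => ->.
have prod_neq0 z : z \notin s -> \prod_(y <- s) (z - y) != 0.
  move=> zs; rewrite prodf_seq_neq0; apply/allP => y ys /=.
  by rewrite subr_eq0; apply: contraNneq zs => ->.
(* The terms at the common nodes match by the partial fractions $(b-a)/((x-a)(x-b)) = 1/(x-b) -
   1/(x-a)$. *)
have sumB : (b - a) * (\sum_(x <- s)
      f x / \prod_(y <- [:: a, b & s] | y != x) (x - y)) =
    \sum_(x <- s) f x / \prod_(y <- b :: s | y != x) (x - y) -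
    \sum_(x <- s) f x / \prod_(y <- a :: s | y != x) (x - y).
  rewrite mulr_sumr -sumrB big_seq [RHS]big_seq; apply: eq_bigr => x xs.
  have ax : a != x by apply: contraNneq as_ => ->.
  have bx : b != x by apply: contraNneq bs => ->.
  rewrite !big_cons ax bx.
  have : \prod_(y <- s | y != x) (x - y) != 0.
    rewrite prodf_seq_neq0; apply/allP => y _.
    by rewrite subr_eq0 eq_sym implybb.
  set Q := \prod_(y <- s | _) _ => Q0.
  by field; rewrite Q0 !subr_eq0 ![x == _]eq_sym ax bx.
rewrite ![\sum_(x <- _ :: _) _]big_cons.
rewrite mulrDr [_ * (_ + \sum_(x <- s) _)]mulrDr sumB.
rewrite !big_cons !eqxx ab eq_sym ab /= !prodN//.
move: (prod_neq0 _ as_) (prod_neq0 _ bs).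
set Pa := \prod_(y <- s) (a - y); set Pb := \prod_(y <- s) (b - y) => Pa0 Pb0.
by field; rewrite Pa0 Pb0 !subr_eq0 ab eq_sym ab.
Qed.

Lemma divided_difference_sum (R : fieldType) (s : seq R) (m : nat)
    (a : nat -> R) (g : nat -> R -> R) :
  divided_difference s (fun x => \sum_(i < m) a i * g i x) =
  \sum_(i < m) a i * divided_difference s (g i).
Proof.
rewrite /divided_difference; under [RHS]eq_bigr do rewrite mulr_sumr.
rewrite exchange_big; apply: eq_bigr => j _; rewrite mulr_suml.
by apply: eq_bigr => i _; rewrite mulrA.
Qed.

Lemma divided_difference_eq0 (R : fieldType) (s : seq R) (f : R -> R) :
  {in s, forall x, f x = 0} -> divided_difference s f = 0.
Proof.
move=> f0; rewrite /divided_difference big1// => i _.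
by rewrite f0 ?mem_nth ?mul0r.
Qed.

Lemma divided_difference_head (R : fieldType) (a : R) (s : seq R) (f : R -> R) :
  uniq (a :: s) -> {in s, forall x, f x = 0} -> f a != 0 ->
  divided_difference (a :: s) f != 0.
Proof.
move=> us f0 fa; rewrite divided_differenceE// big_cons.
rewrite [\sum_(x <- s) _]big_seq.
rewrite [\sum_(x <- s | _) _]big1 ?addr0.
  rewrite mulf_neq0// invr_neq0// prodf_seq_neq0; apply/allP => y _.
  by rewrite subr_eq0 eq_sym implybb.
by move=> x xs; rewrite f0// mul0r.
Qed.

(** * The basis functions as functionals, and their independence *)

(** On a single node the sign and the product are trivial and this is evaluation at the node, so the
    case [k = n] is no longer exceptional. *)
Definition gb_functional (R : fieldType) (s : seq R) (f : R -> R) : R :=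
  (-1) ^+ (size s).-1 * \prod_(x <- behead s) x * divided_difference s f.

Lemma behead_drop (T : Type) (k : nat) (s : seq T) :
  behead (drop k s) = drop k.+1 s.
Proof. by rewrite -drop1 drop_drop. Qed.

Lemma gelfond_bernsteinE (R : realType) (n : nat) (L : n.+1.-tuple R) (k : nat)
    (t : R) : (k <= n)%N ->
  gelfond_bernstein L k t = gb_functional (drop k L) (fun x => t `^ x).
Proof.
move=> kn; rewrite /gelfond_bernstein /gb_functional; case: eqP => [->|_].
  rewrite (drop_nth 0) ?size_tuple// drop_oversize ?size_tuple//=.
  by rewrite big_nil subnn !mul1r divided_difference1.
rewrite behead_drop size_drop size_tuple subSn//=; congr (_ * _ * _).
rewrite (big_nth (0 : R)) size_drop size_tuple -{1}[k.+1]add0n big_addn.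
by apply: eq_bigr => i _; rewrite nth_drop addnC.
Qed.

Lemma gelfond_bernstein_free (R : realType) (V : lmodType R) (n : nat)
    (L : n.+1.-tuple R) (d : nat -> V) : sorted <%R L -> 0 <= L`_0 ->
  (forall t : R, 0 <= t <= 1 ->
    \sum_(k < n.+1) gelfond_bernstein L k t *: d k = 0) ->
  forall k, (k <= n)%N -> d k = 0.
Proof.
move=> sL L0 sum0.
have uL : uniq L by rewrite (sorted_uniq lt_trans (@ltxx _ _)).
pose g m (x : R) := expR (- x) ^+ m.
have g_powR m x : g m x = expR (- m%:R) `^ x.
  by rewrite -expRM /g -expRM_natl mulrN mulNr.
have sum_g m : \sum_(k < n.+1) gb_functional (drop k L) (g m) *: d k = 0.
  have t01 : 0 <= expR (- m%:R : R) <= 1.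
    by rewrite expR_ge0 -[leRHS]expR0 ler_expR oppr_le0 ler0n.
  apply: etrans (sum0 _ t01).
  apply: eq_bigr => k _; congr (_ *: _).
  have kn : (k <= n)%N by rewrite -ltnS.
  rewrite gelfond_bernsteinE//; congr (gb_functional _ _).
  by apply/funext => x; rewrite g_powR.
have sum_p (p : {poly R}) :
    \sum_(k < n.+1)
      gb_functional (drop k L) (fun x => p.[expR (- x)]) *: d k = 0.
  transitivity (\sum_(i < size p) p`_i *:
      \sum_(k < n.+1) gb_functional (drop k L) (g i) *: d k); last first.
    by rewrite big1// => i _; rewrite sum_g scaler0.
  under [RHS]eq_bigr do rewrite scaler_sumr.
  rewrite exchange_big; apply: eq_bigr => k _.
  under [RHS]eq_bigr do rewrite scalerA.
  rewrite -scaler_suml; congr (_ *: _); rewrite /gb_functional.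
  have -> : (fun x => p.[expR (- x)]) =
      (fun x => \sum_(i < size p) p`_i * g i x).
    by apply/funext => x; rewrite horner_coef.
  rewrite (divided_difference_sum _ _ (nth 0 p)) mulr_sumr.
  by apply: eq_bigr => i _; rewrite mulrCA.
elim/ltn_ind => k IH kn.
pose p := \prod_(y <- [seq expR (- x) | x <- drop k.+1 L]) ('X - y%:P).
have p0 : {in drop k.+1 L, forall x, p.[expR (- x)] = 0}.
  by move=> x xL; apply/rootP; rewrite root_prod_XsubC; apply: map_f.
have dropE : drop k L = L`_k :: drop k.+1 L by rewrite (drop_nth 0) ?size_tuple.
have pk : p.[expR (- L`_k)] != 0.
  have : uniq (drop k L) by rewrite drop_uniq.
  rewrite dropE => /andP[kL _]; apply: contra kL.
  rewrite -[_ == 0]/(root p _) root_prod_XsubC.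
  by case/mapP => x xL /expR_inj/oppr_inj ->.
have := sum_p p; rewrite (bigD1 (inord k)) //= inordK ?ltnS// big1 ?addr0.
  move/eqP; rewrite scaler_eq0 => /predU1P[/eqP|/eqP//].
  rewrite /gb_functional !mulf_eq0 signr_eq0 /= dropE /=.
  rewrite (negPf (divided_difference_head _ p0 pk)) -?dropE ?drop_uniq// orbF.
  (* The remaining factor is the product of the nodes after [L]_k[; these exceed]L[_0 >= 0], so none
     of them is zero. *)
  rewrite prodf_seq_eq0 => /hasP[x /(nthP 0)[i]].
  rewrite size_drop size_tuple nth_drop => ik <- /eqP Li0.
  have : L`_0 < L`_(k.+1 + i).
    by rewrite (sorted_ltn_nth lt_trans) ?inE ?size_tuple// -ltn_subRL.
  by rewrite Li0 ltNge L0.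
(* Terms before [k] vanish by induction, terms after [k] because [p] kills all their nodes. *)
move=> i ik; have [ltik|ltki|eqik] := ltngtP i k.
- by rewrite IH ?scaler0 // -ltnS.
- rewrite /gb_functional divided_difference_eq0 ?mulr0 ?scale0r// => x xL.
  by apply: p0; move: xL; rewrite -(subnK ltki) -drop_drop => /mem_drop.
- by move: ik; rewrite -val_eqE /= inordK ?ltnS// eqik eqxx.
Qed.

(** * Inserting a node *)

(** Solve the two-point recurrence for the nodes [a :: s]. The rearrangement gives
    [z * \prod s' = b * \prod s], which converts the normalising products; the extra node [b]
    accounts for the sign. *)
Lemma gb_functional_insert (R : fieldType) (a b z : R) (s s' : seq R)
    (f : R -> R) :
  uniq [:: a, b & s] -> perm_eq (z :: s') (b :: s) -> b != 0 ->
  gb_functional (a :: s) f =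
  (b - a) / b * gb_functional [:: a, z & s'] f +
  z / b * gb_functional (z :: s') f.
Proof.
move=> uabs zs' b0.
have azs' : perm_eq [:: a, z & s'] [:: a, b & s] by rewrite perm_cons.
have uazs' : uniq [:: a, z & s'] by rewrite (perm_uniq azs').
have prodE : z * \prod_(x <- s') x = b * \prod_(x <- s) x.
  have : \prod_(x <- z :: s') x = \prod_(x <- b :: s) x by apply: perm_big.
  by rewrite !big_cons.
have sizeE : size s' = size s by case: (perm_size zs').
have dd_as : divided_difference (a :: s) f = divided_difference (b :: s) f -
    (b - a) * divided_difference [:: a, b & s] f.
  by rewrite divided_difference_rec// subKr.
rewrite /gb_functional (perm_divided_difference f uazs' azs').
rewrite (perm_divided_difference f _ zs'); last by case/andP: uazs'.
rewrite /= big_cons prodE sizeE exprS dd_as mulrACA.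
rewrite [z / b]mulrC.
rewrite -[b^-1 * z * _]mulrA [z * _]mulrA [z * (_ * _)]mulrCA prodE.
by field.
Qed.

Lemma drop_cat_le (T : Type) (k : nat) (u v : seq T) : (k <= size u)%N ->
  drop k (u ++ v) = drop k u ++ v.
Proof.
rewrite drop_cat leq_eqVlt => /predU1P[->|->//].
by rewrite ltnn subnn drop0 drop_size.
Qed.

(** Here [s] counts the entries of [u] below [x]; the last clause trades comparisons with [x] for
    comparisons with [s]. *)
Lemma sorted_insertE (R : realDomainType) (u v : seq R) (x : R) :
  sorted <%R u -> sorted <%R v -> x \notin u -> perm_eq v (rcons u x) ->
  exists2 s, (s <= size u)%N & v = take s u ++ x :: drop s u /\
    (forall i, (i < size u)%N -> (u`_i < x) = (i < s)%N).
Proof.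
move=> su sv xu vux; pose s := find (> x) u.
have nth_lt i : (i < size u)%N -> (u`_i < x) = (i < s)%N.
  move=> iu; have uix : u`_i != x by apply: contraNneq xu => <-; apply: mem_nth.
  case: (ltnP i s) => [/(before_find 0) /=|si].
    by move=> xu_i; rewrite lt_neqAle uix leNgt xu_i.
  apply/negbTE; rewrite -leNgt.
  have us : x < u`_s.
    by apply: (nth_find 0 (a := > x)); rewrite has_find (leq_ltn_trans si).
  apply: (le_trans (ltW us)).
  move: si; rewrite leq_eqVlt => /predU1P[->//|si].
  by rewrite ltW ?(sorted_ltn_nth lt_trans 0 su) ?inE ?(ltn_trans si iu).
exists s; first exact: find_size.
(* A strictly sorted list is determined by its elements, so it suffices that the spliced list is
   sorted. *)
split=> //; apply: (irr_sorted_eq lt_trans (@ltxx _ _)) => //; last first.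
  move=> y; rewrite (perm_mem vux) mem_rcons -{1}(cat_take_drop s u).
  by rewrite !(inE, mem_cat) orbCA.
have take_lt y : y \in take s u -> y < x.
  case/(nthP 0) => i; rewrite size_take_min leq_min => /andP[is_ iu] <-.
  by rewrite nth_take// nth_lt.
have drop_gt y : y \in drop s u -> x < y.
  move=> /[dup] ydrop; case/(nthP 0) => i.
  rewrite size_drop ltn_subRL nth_drop => iu yE.
  have : ~~ (y < x) by rewrite -yE nth_lt// -leqNgt leq_addr.
  rewrite -leNgt le_eqVlt => /predU1P[xy|//].
  by move: xu; rewrite xy (mem_drop ydrop).
move: su; rewrite -{1}(cat_take_drop s u).
rewrite !(sorted_pairwise lt_trans) !pairwise_cat.
case/and3P => ltud -> ud; rewrite /= ud allrel_consr ltud !andbT.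
by apply/andP; split; apply/allP.
Qed.

Lemma gelfond_bernstein_insert (R : realType) (n : nat) (L1 : n.+1.-tuple R)
    (L2 : n.+2.-tuple R) (rho : R) (s k : nat) (t : R) :
  uniq L1 -> rho \notin L1 -> rho != 0 -> (s <= n.+1)%N ->
  L2 = take s L1 ++ rho :: drop s L1 :> seq R -> (k <= n)%N ->
  gelfond_bernstein L1 k t =
  if (k < s)%N then
    (rho - L1`_k) / rho * gelfond_bernstein L2 k t +
    L2`_k.+1 / rho * gelfond_bernstein L2 k.+1 t
  else gelfond_bernstein L2 k.+1 t.
Proof.
move=> uL1 rhoL1 rho0 sn L2E kn.
have size_take_s : size (take s L1) = s by rewrite size_takel ?size_tuple.
rewrite !gelfond_bernsteinE ?(leqW kn)//; case: ltnP => ks; last first.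
  rewrite L2E drop_cat size_take_s ltnNge (leqW ks) subSn//=.
  by rewrite drop_drop subnK.
have dropL1 : drop k L1 = L1`_k :: drop k.+1 L1.
  by rewrite (drop_nth 0) ?size_tuple.
have dropL2 : drop k.+1 L2 = L2`_k.+1 :: drop k.+2 L2.
  by rewrite (drop_nth 0) ?size_tuple.
have L2k : L2`_k = L1`_k by rewrite L2E nth_cat size_take_s ks nth_take.
rewrite [drop k L2](drop_nth 0) ?size_tuple ?ltnS ?leqW// L2k dropL1 dropL2.
apply: gb_functional_insert => //.
  have : uniq (drop k L1) by rewrite drop_uniq.
  rewrite dropL1 /= inE => /andP[kL1 ->]; rewrite negb_or kL1 !andbT.
  apply/andP; split; last by apply: contra rhoL1 => /mem_drop.
  by apply: contraNneq rhoL1 => <-; rewrite mem_nth ?size_tuple.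
rewrite -dropL2 L2E drop_cat_le ?size_take_s//.
rewrite -[in X in perm_eq _ (_ :: X)](cat_take_drop s L1).
by rewrite drop_cat_le ?size_take_s// -cat1s perm_catCA.
Qed.

(* MathComp world.  V covers both real coefficients (V := R^o) and points of
   R^d (V := 'rV[R]_d). *)
Theorem corollary3 (R : realType) (V : vectType R) (n : nat) (hn : (1 <= n)%N)
    (L1 : n.+1.-tuple R) (hL1_0 : L1`_0 = 0) (hL1 : sorted <%R L1)
    (rho : R) (hrho : 0 < rho) (hrhoL1 : rho \notin L1)
    (L2 : n.+2.-tuple R) (hL2 : sorted <%R L2) (hL12 : perm_eq L2 (rcons L1 rho))
    (c : n.+1.-tuple V) (c' : n.+2.-tuple V) (P : R -> V)
    (hP1 : forall t : R, 0 <= t <= 1 ->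
       P t = \sum_(k < n.+1) gelfond_bernstein L1 k t *: c`_k)
    (hP2 : forall t : R, 0 <= t <= 1 ->
       P t = \sum_(k < n.+2) gelfond_bernstein L2 k t *: c'`_k) :
  [/\ c'`_0 = c`_0 /\ c'`_n.+1 = c`_n,
      L1`_n < rho ->
        forall k : nat, (1 <= k <= n)%N ->
          c'`_k = (L1`_k / rho) *: c`_k.-1 + ((rho - L1`_k) / rho) *: c`_k,
      rho < L1`_1 ->
        forall k : nat, (k <= n.-1)%N -> c'`_k.+1 = c`_k
    & forall s : nat, (2 <= s <= n)%N -> L1`_s.-1 < rho < L1`_s ->
        (forall k : nat, (1 <= k <= s.-1)%N ->
          c'`_k = (L1`_k / rho) *: c`_k.-1 + ((rho - L1`_k) / rho) *: c`_k) /\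
        (forall k : nat, (s <= k <= n.+1)%N -> c'`_k = c`_k.-1)].
Proof.
have rho0 : rho != 0 by rewrite gt_eqF.
have uL1 : uniq L1 by rewrite (sorted_uniq lt_trans (@ltxx _ _)).
(* This [s] covers all cases at once: it is [n.+1] in (i), [1] in (ii), and the given index in
   (iii). *)
have [s] := sorted_insertE hL1 hL2 hrhoL1 hL12.
rewrite size_tuple => sn [L2E ltE].
have s0 : (0 < s)%N by rewrite -ltE// hL1_0.
have size_take_s : size (take s L1) = s by rewrite size_takel ?size_tuple.
have L2_lt k : (k < s)%N -> L2`_k = L1`_k.
  by move=> ks; rewrite L2E nth_cat size_take_s ks nth_take.
have L2_s : L2`_s = rho by rewrite L2E nth_cat size_take_s ltnn subnn.
(* [A k] and [B k] are the weights of the [k]-th new basis function in the [k]-th and [k.-1]-th old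
   ones; hence the test [k <= s], that is [k.-1 < s], in [B]. *)
pose A k := if (k < s)%N then (rho - L1`_k) / rho else 0.
pose B k := if (k <= s)%N then L2`_k / rho else 1.
have c'E k : (k <= n.+1)%N -> c'`_k = A k *: c`_k + B k *: c`_k.-1.
  move=> kn; apply/eqP; rewrite -subr_eq0; apply/eqP; move: k kn.
  apply: (gelfond_bernstein_free hL2); first by rewrite L2_lt// hL1_0.
  move=> t t01; under eq_bigr do rewrite scalerBr scalerDr.
  rewrite sumrB -hP2// hP1// big_split /=.
  rewrite [X in _ - (X + _)]big_ord_recr [X in _ - (_ + X)]big_ord_recl /=.
  (* The two boundary terms, with the out-of-range [c]_n.+1[and the spurious]c[_0.-1], have weight
     zero; the latter because the first node is 0. *)
  have -> : A n.+1 = 0 by rewrite /A ltnNge sn.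
  have -> : B 0 = 0 by rewrite /B leq0n L2_lt// hL1_0 mul0r.
  rewrite !scale0r !scaler0 addr0 add0r -big_split -sumrB big1// => k _ /=.
  have kn : (k <= n)%N by rewrite -ltnS.
  rewrite (gelfond_bernstein_insert t uL1 hrhoL1 rho0 sn L2E kn) /A /B /=.
  case: ltnP => ks; last by rewrite scale0r scaler0 add0r scale1r subrr.
  by rewrite scalerDl !scalerA 2![gelfond_bernstein _ _ _ * _]mulrC subrr.
have c'_lt k : (k < s)%N ->
    c'`_k = (L1`_k / rho) *: c`_k.-1 + ((rho - L1`_k) / rho) *: c`_k.
  move=> ks; rewrite c'E ?(leq_trans (ltnW ks))// /A /B ks ltnW// L2_lt//.
  by rewrite addrC.
have c'_ge k : (s <= k <= n.+1)%N -> c'`_k = c`_k.-1.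
  case/andP => sk kn; rewrite c'E// /A /B ltnNge sk scale0r add0r.
  case: leqP => [ks|_]; last by rewrite scale1r.
  have -> : k = s by apply/eqP; rewrite eqn_leq ks.
  by rewrite L2_s divff// scale1r.
split; [split|move=> ltn k /andP[_ kn]|move=> lt1 k kn|].
- by rewrite c'_lt// hL1_0 mul0r scale0r add0r subr0 divff// scale1r.
- by rewrite c'_ge// sn leqnn.
- by apply: c'_lt; move: ltn; rewrite ltE ?size_tuple// => /(leq_ltn_trans kn).
- apply: c'_ge; rewrite ltnS (leq_trans kn) ?leq_pred// andbT.
  rewrite (@leq_trans 1)// leqNgt -ltE ?size_tuple ?ltnS//.
  by rewrite -leNgt ltW.
- move=> s' /andP[s'2 s'n] /andP[lt_s' gt_s'].
  (* Both indices count the entries of [L1] below [rho]. *)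
  have ss' : s = s'.
    apply/eqP; rewrite eqn_leq leqNgt -ltE ?size_tuple// -leNgt ltW//=.
    by move: lt_s'; rewrite ltE ?size_tuple ?prednK// ltnW// ltnS ltnW.
  rewrite -ss'; split=> k; last exact: c'_ge.
  by case/andP => _ ks; apply: c'_lt; rewrite -(prednK s0).
Qed.
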